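(* Let $G$ be a finite non-abelian group and let $\alpha=|Z(G)|/|G|$. Then $$P_3(G)\le \frac14+\frac{\alpha}{4}+\frac{\alpha^2}{2}.$$ Consequently, if $P_3(G)>\frac{11}{36}$ then $|G:Z(G)|=4$ and hence $G/Z(G)\cong C_2\times C_2$.
   Context: $P_3(G)$ is the proportion of triples in $G^3$ whose entries commute pairwise: $P_3(G)=|\{(x_1,x_2,x_3)\in G^3: x_ix_j=x_jx_i\ \forall i,j\}|/|G|^3$. $Z(G)$ is the center of $G$, and $C_2$ is the cyclic group of order $2$. *)

(* Defs.v *)
From mathcomp Require Import all_boot all_order all_algebra all_fingroup all_solvable.

Set Implicit Arguments.
Unset Strict Implicit.
Unset Printing Implicit Defensive.

Import GRing.Theory Num.Theory.

Local Open Scope ring_scope.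

Definition commuting_triples (gT : finGroupType) (G : {set gT}) :
    {set 3.-tuple gT} :=
  [set x : 3.-tuple gT |
    [forall i, tnth x i \in G]
    && [forall i, forall j,
          (tnth x i * tnth x j)%g == (tnth x j * tnth x i)%g]].

Definition P3 (gT : finGroupType) (G : {set gT}) : rat :=
  #|commuting_triples G|%:R / (#|G| ^ 3)%N%:R.

Definition center_ratio (gT : finGroupType) (G : {set gT}) : rat :=
  #|'Z(G)%g|%:R / #|G|%:R.

(* The canonical group law on 'Z_2 is addition, so this is C_2 x C_2 written
   additively. *)
Definition C2xC2 : {set 'Z_2 * 'Z_2} := [set: 'Z_2 * 'Z_2].

(* Main.v *)
Require Import Defs.
From mathcomp Require Import all_boot all_order all_algebra all_fingroup all_solvable.
From mathcomp Require Import ring lra.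

(** Fixing the first entry [x] of a commuting triple, the other two entries
    form a commuting pair of the centralizer of [x].  So the number of
    commuting triples of [G] is the sum over [x] of the number of commuting
    pairs of ['C_G[x]], and that number is in turn a sum of orders of
    centralizers.  An element outside the center has a proper centralizer,
    whose order is at most [#|G| / 2].  Writing [a] for [#|Z(G)| / #|G|], the
    proportion of commuting pairs of [G] is hence at most
    [a + (1 - a) / 2 = (1 + a) / 2].  A central [x], whose centralizer is [G],
    contributes at most this proportion to the average [P3 G], and a
    noncentral [x] contributes at most [(1 / 2) ^ 2 = 1 / 4], all pairs of its
    centralizer being counted.  Averaging,
    [P3 G <= a * (1 + a) / 2 + (1 - a) / 4], the announced bound
    ([card_commuting_triples_le]).

    The bound increases with [a] and equals [11 / 36] at [a = 1 / 6].  If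
    [P3 G] is larger, the center thus has index less than [6].  As [G] is not
    abelian, [G / Z(G)] is not cyclic, so the index is neither [1] nor a prime
    ([ncyclic_card_lt6]).  This leaves [4], and a noncyclic group of order [4]
    is elementary abelian. *)

Set Implicit Arguments.
Unset Strict Implicit.
Unset Printing Implicit Defensive.

Import GRing.Theory Num.Theory.

Section CommutingTuples.

Variable gT : finGroupType.
Implicit Types G H : {group gT}.

Definition commuting_pairs (A : {set gT}) : nat :=
  \sum_(x in A) #|'C_A[x]%g|.

Lemma commuting_pairs_le_sqr (A : {set gT}) : commuting_pairs A <= #|A| ^ 2.
Proof.
rewrite /commuting_pairs -mulnn -sum_nat_const.
by apply: leq_sum => x _; rewrite subset_leq_card // subsetIl.
Qed.

Lemma mem_commuting_triples (A : {set gT}) (x y z : gT) :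
  ([tuple x; y; z] \in commuting_triples A) =
    [&& x \in A, y \in 'C_A[x]%g & z \in 'C_('C_A[x])[y]%g].
Proof.
rewrite inE; apply/andP/and3P.
  move=> [/forallP mA /forallP cA].
  have c i j := eqP (forallP (cA i) j).
  have /= mx := mA (inord 0); have /= my := mA (inord 1).
  have /= mz := mA (inord 2).
  have cxy := c (inord 0) (inord 1); have cxz := c (inord 0) (inord 2).
  have cyz := c (inord 1) (inord 2).
  move: mx my mz cxy cxz cyz; rewrite !(tnth_nth x) !inordK //=.
  move=> mx my mz cxy cxz cyz; rewrite !in_setI mx my mz /=.
  by split=> //; [apply/cent1P | apply/andP; split; apply/cent1P].
move=> [mx /setIP[my /cent1P cxy] /setIP[/setIP[mz /cent1P cxz] /cent1P cyz]].
split; first by apply/forallP=> -[[|[|[|i]]] lti] //=; rewrite (tnth_nth x).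
apply/forallP=> -[[|[|[|i]]] lti] //; apply/forallP=> -[[|[|[|j]]] ltj] //;
  by apply/eqP; rewrite !(tnth_nth x) /=.
Qed.

(** The entries of a commuting triple after the first one, [x], form a
    commuting pair of the centralizer of [x]. *)
Lemma card_commuting_triples (A : {set gT}) :
  #|commuting_triples A| = \sum_(x in A) commuting_pairs 'C_A[x]%g.
Proof.
rewrite /commuting_pairs; under eq_bigr => x _ do
  under eq_bigr => y _ do rewrite -sum1_card.
under eq_bigr => x _ do rewrite pair_big_dep /=.
rewrite pair_big_dep /= -sum1_card.
pose triple (u : gT * (gT * gT)) := [tuple u.1; u.2.1; u.2.2].
rewrite (reindex triple) /=; last first.
  apply: onW_bij; exists (fun t : 3.-tuple gT =>
    (tnth t (inord 0), (tnth t (inord 1), tnth t (inord 2)))).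
    by case=> x [y z]; rewrite !(tnth_nth x) !inordK.
  case/tupleP=> x t; case/tupleP: t => y t; case/tupleP: t => z t.
  by apply/val_inj; rewrite /= !(tnth_nth x) !inordK //= (tuple0 t).
by apply: eq_bigl => -[x [y z]]; rewrite /triple mem_commuting_triples.
Qed.

Lemma cent1_center G x : x \in 'Z(G)%g -> 'C_G[x]%g = G.
Proof. by case/setIP=> _; rewrite -sub_cent1 => /setIidPl. Qed.

(** The centralizer of a noncentral element is a proper subgroup, so its
    index is at least [2]. *)
Lemma card_cent1_noncentral G x :
  x \in G -> x \notin 'Z(G)%g -> 2 * #|'C_G[x]%g| <= #|G|.
Proof.
move=> Gx; rewrite inE Gx /= -sub_cent1 => nCx.
rewrite -(Lagrange (subsetIl G 'C[x]%g)) mulnC leq_mul2l indexg_gt1.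
by rewrite subsetI subxx /= nCx orbT.
Qed.

Lemma card_center_split G : #|G| = #|'Z(G)%g| + #|G :\: 'Z(G)%g|.
Proof. by rewrite -(cardsID 'Z(G)%g G) (setIidPr (center_sub G)). Qed.

(** Applied twice: to the inner count of commuting pairs and to the outer count
    of triples, central and noncentral elements being bounded differently. *)
Lemma sum_center_le G (F : gT -> nat) a b :
    {in 'Z(G)%g, forall x, F x <= a} ->
    {in G, forall x, x \notin 'Z(G)%g -> F x <= b} ->
  \sum_(x in G) F x <= #|'Z(G)%g| * a + #|G :\: 'Z(G)%g| * b.
Proof.
move=> Fa Fb; have sZG := center_sub G.
rewrite (big_setID 'Z(G)%g) /= (setIidPr sZG) leq_add //.
  by rewrite -sum_nat_const leq_sum.
by rewrite -sum_nat_const leq_sum // => x /setDP[]; apply: Fb.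
Qed.

Lemma commuting_pairs_le G :
  2 * commuting_pairs G <= #|G| * (#|G| + #|'Z(G)%g|).
Proof.
rewrite big_distrr /=.
apply: leq_trans (sum_center_le (a := 2 * #|G|) (b := #|G|) _ _) _.
- by move=> x Zx; rewrite cent1_center.
- by move=> x Gx nZx; apply: card_cent1_noncentral.
- by rewrite card_center_split eq_leq //; ring.
Qed.

Lemma card_commuting_triples_le G :
  4 * #|commuting_triples G| <=
    #|G| ^ 3 + #|G| ^ 2 * #|'Z(G)%g| + 2 * #|G| * #|'Z(G)%g| ^ 2.
Proof.
rewrite card_commuting_triples big_distrr /=.
apply: leq_trans (sum_center_le (a := 2 * (#|G| * (#|G| + #|'Z(G)%g|)))
                                (b := #|G| ^ 2) _ _) _.
- move=> x Zx; rewrite cent1_center // -[4]/(2 * 2) -mulnA leq_mul2l /=.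
  exact: commuting_pairs_le.
- move=> x Gx nZx; have leC := card_cent1_noncentral Gx nZx.
  apply: leq_trans (_ : (2 * #|'C_G[x]%g|) ^ 2 <= _); last by rewrite leq_exp2r.
  by rewrite expnMn leq_mul2l commuting_pairs_le_sqr.
- by rewrite card_center_split eq_leq //; ring.
Qed.

(** Groups of prime order being cyclic, [4] is the only possible order below
    [6] for a noncyclic group. *)
Lemma ncyclic_card_lt6 H : ~~ cyclic H -> #|H| < 6 -> #|H| = 4.
Proof.
move=> ncH.
have nprH : ~~ prime #|H| by apply: contra ncH; apply: prime_cyclic.
have ntH : #|H| != 1.
  by apply: contra ncH => /eqP/card1_trivg->; apply: cyclic1.
have := cardG_gt0 H.
by move: nprH ntH; case: #|H| => [|[|[|[|[|[|]]]]]].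
Qed.

(** An element of order [4] would generate the group, so all orders
    divide [2]. *)
Lemma ncyclic4_abelem H : ~~ cyclic H -> #|H| = 4 -> 2.-abelem%g H.
Proof.
move=> ncH oH; apply/(abelemP (erefl : prime 2)); split.
  by apply: (@p2group_abelian _ 2); rewrite /pgroup oH.
move=> x Hx; apply/eqP; rewrite -order_dvdn.
have : #[x]%g %| 4 by rewrite -oH order_dvdG.
have : #[x]%g != 4.
  apply: contra ncH => /eqP ox; apply/cyclicP; exists x; apply/eqP.
  by rewrite eq_sym eqEcard cycle_subG Hx oH -ox leqnn.
move=> nx4 dx4; have := dvdn_leq (erefl : 0 < 4) dx4; move: nx4 dx4.
by case: #[x]%g => [|[|[|[|[|]]]]].
Qed.

Lemma C2xC2_abelem : 2.-abelem%g C2xC2.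
Proof.
apply/(abelemP (erefl : prime 2)); split.
  by apply/centsP=> -[a b] _ [c d] _; congr pair; apply: Zp_addC.
by move=> [[[|[|]] //= lta] [[|[|]] //= ltb]] _; congr pair; apply/val_inj.
Qed.

Lemma ncyclic4_isog_C2xC2 H : ~~ cyclic H -> #|H| = 4 -> (H \isog C2xC2)%g.
Proof.
move=> ncH oH; rewrite (isog_abelem_card _ (ncyclic4_abelem ncH oH)).
by rewrite C2xC2_abelem oH cardsT card_prod card_ord.
Qed.

End CommutingTuples.

Local Open Scope ring_scope.

Theorem proposition6p1 (gT : finGroupType) (G : {group gT})
    (nabG : ~~ abelian G) :
  let alpha := center_ratio G in
  P3 G <= 1 / 4 + alpha / 4 + alpha ^+ 2 / 2 /\
  (P3 G > 11 / 36 ->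
     #|G : 'Z(G)|%g = 4%N /\ (G / 'Z(G))%g \isog C2xC2).
Proof.
move=> alpha.
have n_gt0 : 0 < #|G|%:R :> rat by rewrite ltr0n cardG_gt0.
have P3_le : P3 G <= 1 / 4 + alpha / 4 + alpha ^+ 2 / 2.
  have := card_commuting_triples_le G.
  rewrite -(ler_nat rat) !(natrD, natrX, natrM) => le4.
  rewrite /P3 natrX ler_pdivrMr ?exprn_gt0 //.
  have -> : (1 / 4 + alpha / 4 + alpha ^+ 2 / 2) * #|G|%:R ^+ 3 =
      (#|G|%:R ^+ 3 + #|G|%:R ^+ 2 * #|'Z(G)%g|%:R
        + 2 * #|G|%:R * #|'Z(G)%g|%:R ^+ 2) / 4.
    by rewrite /alpha /center_ratio; field; rewrite lt0r_neq0.
  by lra.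
split=> // P3_gt.
have oQ : #|(G / 'Z(G))%g| = #|G : 'Z(G)|%g.
  by rewrite card_quotient // normal_norm // center_normal.
have ncQ : ~~ cyclic (G / 'Z(G))%g.
  by apply: contra nabG; apply: cyclic_center_factor_abelian.
have idx_lt6 : (#|G : 'Z(G)|%g < 6)%N.
  rewrite ltnNge; apply/negP => idx_ge6.
  have a_ge0 : 0 <= alpha by rewrite divr_ge0 // ler0n.
  have a_le : alpha <= 1 / 6.
    rewrite /alpha /center_ratio ler_pdivrMr //.
    have : (6 * #|'Z(G)%g| <= #|G|)%N.
      by rewrite -(Lagrange (center_sub G)) mulnC leq_mul2l idx_ge6 orbT.
    by rewrite -(ler_nat rat) natrM; lra.
  by nra.
have oQ4 : #|(G / 'Z(G))%g| = 4%N by apply: ncyclic_card_lt6; rewrite ?oQ.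
by split; [rewrite -oQ | apply: ncyclic4_isog_C2xC2].
Qed.
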